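(* Let $C$ be a knot-like complex, and assume $C$ is locally equivalent to the standard complex $C(a_1,\dots,a_n)$. Then $C$ is homotopy equivalent to $C(a_1,\dots,a_n)\oplus A$ for some $\mathcal{R}$-complex $A$.
   Context: Conventions: $\mathbb{F}=\mathbb{Z}/2\mathbb{Z}$. Let $\mathcal{R}=\mathbb{F}[U,V]/(UV)$, with bigrading $\mathrm{gr}=(\mathrm{gr}_U,\mathrm{gr}_V)$, $\mathrm{gr}(U)=(-2,0)$, $\mathrm{gr}(V)=(0,-2)$. Knot-like complexes. A knot-like complex $C$ is a free, finitely generated, bigraded chain complex over $\mathcal{R}$, with differential of degree $(-1,-1)$, such that (1) $H_*(C/U)/V\text{-torsion}\cong\mathbb{F}[V]$ and all $V$-nontorsion classes in $H_*(C/U)$ have $\mathrm{gr}_U=0$; (2) $H_*(C/V)/U\text{-torsion}\cong\mathbb{F}[U]$ and all $U$-nontorsion classes in $H_*(C/V)$ have $\mathrm{gr}_V=0$. Write $C_1\le C_2$ if there is a local map $f\colon C_1\to C_2$, i.e. an $\mathcal{R}$-equivariant chain map that preserves $\mathrm{gr}_U$, shifts $\mathrm{gr}_V$ by a constant, and induces an isomorphism $H_*(C_1/U)/V\text{-torsion}\to H_*(C_2/U)/V\text{-torsion}$. $C_1$ and $C_2$ are locally equivalent, $C_1\sim C_2$, if $C_1\le C_2$ and $C_2\le C_1$. Standard complexes. For $n\ge 0$ even and nonzero integers $b_1,\dots,b_n$, the standard complex $C(b_1,\dots,b_n)$ is freely generated over $\mathcal{R}$ by $x_0,\dots,x_n$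 with $\partial=\partial_U+\partial_V$, where for $i$ odd: $\partial_U x_{i-1}=U^{|b_i|}x_i$ if $b_i<0$, and $\partial_U x_i=U^{b_i}x_{i-1}$ if $b_i>0$; for $i$ even: $\partial_V x_{i-1}=V^{|b_i|}x_i$ if $b_i<0$, and $\partial_V x_i=V^{b_i}x_{i-1}$ if $b_i>0$; all other $\partial_U,\partial_V$ of generators vanish. The bigrading is the unique one with $\mathrm{gr}_U(x_0)=0$, $\mathrm{gr}_V(x_n)=0$ and $\partial$ of degree $(-1,-1)$. For $n=0$ this is the trivial complex $C(0)=\mathcal{R}$. *)

(* Defs.v *)
From HB Require Import structures.
From mathcomp Require Import all_boot all_order all_algebra.
From mathcomp Require Import boolp.
From mathcomp Require Import zify ring.

Set Implicit Arguments.
Unset Strict Implicit.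
Unset Printing Implicit Defensive.

Import Order.TTheory GRing.Theory Num.Theory.
Local Open Scope ring_scope.
Local Open Scope quotient_scope.

(** * The ring R = F[U,V]/(UV) *)

Local Notation F := 'F_2.

(* F[U,V] is F[U][V]: U is the inner indeterminate, V the outer one. *)
Definition polyUV : comNzRingType := {poly {poly F}}.
Definition polyU : polyUV := ('X : {poly F})%:P.
Definition polyV : polyUV := 'X.

Definition idealUV : {pred polyUV} :=
  fun p => `[< exists q : polyUV, p = q * (polyU * polyV) >].

Lemma idealUV_closed : idealr_closed idealUV.
Proof.
split.
- by apply/asboolP; exists 0; rewrite mul0r.
- apply/negP; rewrite unfold_in /idealUV => /asboolP[q].
  rewrite /polyV mulrA => /(congr1 (coefp 0)).
  by rewrite /= coefMX coef1 => /eqP; rewrite oner_eq0.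
- move=> p u v /asboolP[q ->] /asboolP[q' ->]; apply/asboolP.
  by exists (p * q + q'); rewrite mulrDl -(mulrA p).
Qed.

HB.instance Definition _ := isIdealr.Build polyUV idealUV idealUV_closed.

Definition R : comNzRingType := {ideal_quot idealUV}.
Definition U : R := \pi_({ideal_quot idealUV}) polyU.
Definition V : R := \pi_({ideal_quot idealUV}) polyV.

Lemma mulUV : U * V = 0.
Proof.
rewrite /U /V -[_ * _](rmorphM (\pi_({ideal_quot idealUV}))).
rewrite -[RHS](rmorph0 (\pi_({ideal_quot idealUV}))).
apply/eqP; rewrite -Quotient.idealrBE subr0.
by apply/asboolP; exists 1; rewrite mul1r.
Qed.

Lemma R_char2 : 1 + 1 = 0 :> R.
Proof.
have e : (1 + 1 : polyUV) = 0.
  rewrite -[1 : polyUV]/((1 : {poly F})%:P) -polyCD -polyC1 -polyCD.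
  by rewrite (_ : 1 + 1 = 0 :> F) ?polyC0 //; apply/val_inj.
rewrite -[1 : R](rmorph1 (\pi_({ideal_quot idealUV}))) -rmorphD e.
exact: rmorph0.
Qed.

Definition degU : int * int := (- 2, 0).
Definition degV : int * int := (0, - 2).

(* [homogR p r]: r lies in the bidegree p summand of R, which is spanned over
   F = {0, 1} by at most one nonzero monomial. *)
Definition homogR (p : int * int) (r : R) : Prop :=
  r = 0 \/ exists i j : nat, p = degU *+ i + degV *+ j /\ r = U ^+ i * V ^+ j.

Lemma degUVE i j :
  degU *+ i + degV *+ j = (- 2 *+ i, - 2 *+ j) :> (int * int)%type.
Proof.
have mE (x : int * int) k : x *+ k = (x.1 *+ k, x.2 *+ k).
  by elim: k => [|k IH]; rewrite ?mulr0n // !mulrS IH.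
by rewrite !mE /= !mul0rn; congr pair; rewrite ?addr0 ?add0r.
Qed.

Lemma homogR0 p : homogR p 0. Proof. by left. Qed.

Lemma homogRD p r s : homogR p r -> homogR p s -> homogR p (r + s).
Proof.
case=> [->|[i [j [Ep Er]]]]; first by rewrite add0r.
case=> [->|[i' [j' [Ep' Es]]]].
  by rewrite addr0; right; exists i, j.
left; move: Ep'; rewrite Ep !degUVE => -[Ei Ej].
have [ei ej] : i = i' /\ j = j' by lia.
by rewrite Er Es ei ej -[X in X + _]mul1r -[X in _ + X]mul1r -mulrDl R_char2 mul0r.
Qed.

Lemma homogRM p q r s : homogR p r -> homogR q s -> homogR (p + q) (r * s).
Proof.
case=> [->|[i [j [-> ->]]]]; first by rewrite mul0r; left.
case=> [->|[i' [j' [-> ->]]]]; first by rewrite mulr0; left.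
right; exists (i + i')%N, (j + j')%N; split; last by rewrite !exprD mulrACA.
by rewrite !mulrnDr addrACA.
Qed.

(** * Submodules and quotient modules *)

Section QuotientModule.
Variables (A : comNzRingType) (M : lmodType A) (S : submodClosed M).

(* [submodClosed] does not inherit from [zmodClosed], which the quotient
   construction requires. *)
Definition submod_pred : {pred M} := fun x => x \in S.

Lemma submod_pred_closed : zmod_closed submod_pred.
Proof.
split=> [|x y xS yS]; first exact: (rpred0 S).
have : x - y \in S by rewrite -scaleN1r rpredD ?rpredZ.
by [].
Qed.

HB.instance Definition _ :=
  GRing.isZmodClosed.Build M submod_pred submod_pred_closed.

Definition modquot := Quotient.quot submod_pred.

HB.instance Definition _ := Choice.on modquot.
HB.instance Definition _ := GRing.Zmodule.on modquot.

Definition modproj : M -> modquot := \pi_(Quotient.quot submod_pred).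

Definition modquot_scale (a : A) (h : modquot) : modquot :=
  modproj (a *: repr h).

Lemma modprojD x y : modproj (x + y) = modproj x + modproj y.
Proof. exact: (raddfD \pi_(Quotient.quot submod_pred)). Qed.

Lemma modproj_eq x y : modproj x = modproj y <-> x - y \in S.
Proof. by split=> [/eqP|] h; [|apply/eqP]; move: h; rewrite -Quotient.idealrBE. Qed.

Lemma modproj_repr h : modproj (repr h) = h.
Proof. exact: reprK. Qed.

Lemma modquot_scaleE a x : modquot_scale a (modproj x) = modproj (a *: x).
Proof.
apply/modproj_eq; rewrite -scalerBr rpredZ //.
by apply/modproj_eq; rewrite modproj_repr.
Qed.

Lemma modquot_scaleA a b h :
  modquot_scale a (modquot_scale b h) = modquot_scale (a * b) h.
Proof. by rewrite -[h]modproj_repr !modquot_scaleE scalerA. Qed.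

Lemma modquot_scale1 : left_id 1 modquot_scale.
Proof. by move=> h; rewrite -[h]modproj_repr modquot_scaleE scale1r. Qed.

Lemma modquot_scaleDr : right_distributive modquot_scale +%R.
Proof.
move=> a h k; rewrite -[h]modproj_repr -[k]modproj_repr -modprojD.
by rewrite !modquot_scaleE scalerDr modprojD.
Qed.

Lemma modquot_scaleDl h : {morph modquot_scale^~ h : a b / a + b}.
Proof.
by move=> a b; rewrite -[h]modproj_repr !modquot_scaleE scalerDl modprojD.
Qed.

HB.instance Definition _ := GRing.Zmodule_isLmodule.Build A modquot
  modquot_scaleA modquot_scale1 modquot_scaleDr modquot_scaleDl.

Lemma modproj_linear : linear modproj.
Proof. by move=> a x y; rewrite modprojD -modquot_scaleE. Qed.

HB.instance Definition _ :=
  GRing.isLinear.Build A M modquot *:%R modproj modproj_linear.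

End QuotientModule.

Section Submodules.
Variables (A : comNzRingType) (M : lmodType A).

(* The submodule sM. *)
Definition scaled (s : A) : {pred M} := fun x => `[< exists y, x = s *: y >].

Lemma scaled_closed s : submod_closed (scaled s).
Proof.
split; first by apply/asboolP; exists 0; rewrite scaler0.
move=> a x y /asboolP[x' ->] /asboolP[y' ->]; apply/asboolP.
by exists (a *: x' + y'); rewrite scalerDr !scalerA mulrC.
Qed.

HB.instance Definition _ s :=
  GRing.isSubmodClosed.Build A M (scaled s) (scaled_closed s).

(* The elements of M killed by a power of t. *)
Definition torsion (t : A) : {pred M} :=
  fun x => `[< exists k, t ^+ k *: x = 0 >].

Lemma torsion_closed t : submod_closed (torsion t).
Proof.
split; first by apply/asboolP; exists 0%N; rewrite scaler0.
move=> a x y /asboolP[k hk] /asboolP[l hl]; apply/asboolP; exists (k + l)%N.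
have -> : t ^+ (k + l) *: (a *: x + y)
    = (a * t ^+ l) *: (t ^+ k *: x) + t ^+ k *: (t ^+ l *: y).
  by rewrite scalerDr !scalerA -exprD -mulrA -exprD [(l + k)%N]addnC mulrC.
by rewrite hk hl !scaler0 addr0.
Qed.

HB.instance Definition _ t :=
  GRing.isSubmodClosed.Build A M (torsion t) (torsion_closed t).

End Submodules.

Arguments scaled {A} M s.
Arguments torsion {A} M t.

(** * H_*(M/s)/t-torsion, for a module M with an endomorphism d *)

Section Homology.
Variables (A : comNzRingType) (M : lmodType A) (d : {linear M -> M}) (s t : A).

Definition modS := modquot (scaled M s).

HB.instance Definition _ := GRing.Lmodule.on modS.

Definition projS (x : M) : modS := modproj (scaled M s) x.

Lemma projS_linear : linear projS.
Proof. exact: modproj_linear. Qed.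

HB.instance Definition _ :=
  GRing.isLinear.Build A M modS *:%R projS projS_linear.

Definition diffS (c : modS) : modS := projS (d (repr c)).

Lemma diffSE x : diffS (projS x) = projS (d x).
Proof.
apply/modproj_eq; rewrite -linearB.
have /asboolP[y ->] : repr (projS x) - x \in scaled M s.
  by apply/modproj_eq; rewrite modproj_repr.
by apply/asboolP; exists (d y); rewrite linearZ.
Qed.

Lemma diffS_linear : linear diffS.
Proof.
move=> a x y; rewrite -[x]modproj_repr -[y]modproj_repr -!/(projS _).
by rewrite -linearP !diffSE !linearP.
Qed.

HB.instance Definition _ :=
  GRing.isLinear.Build A modS modS *:%R diffS diffS_linear.

Definition is_cycle : {pred modS} := fun c => diffS c == 0.

Lemma is_cycle_closed : submod_closed is_cycle.
Proof.
split; first by apply/eqP; rewrite linear0.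
move=> a x y /eqP hx /eqP hy; apply/eqP.
by rewrite linearP /= hx hy scaler0 addr0.
Qed.

HB.instance Definition _ :=
  GRing.isSubmodClosed.Build A modS is_cycle is_cycle_closed.

Record cycles := Cycle { cycle_val :> modS; _ : cycle_val \in is_cycle }.

HB.instance Definition _ := [isSub for cycle_val].
HB.instance Definition _ := [Choice of cycles by <:].
HB.instance Definition _ := [SubChoice_isSubLmodule of cycles by <:].

Definition is_boundary : {pred cycles} :=
  fun z => `[< exists c : modS, val z = diffS c >].

Lemma is_boundary_closed : submod_closed is_boundary.
Proof.
split; first by apply/asboolP; exists 0; rewrite linear0 /= raddf0.
move=> a x y /asboolP[x' hx] /asboolP[y' hy]; apply/asboolP.
by exists (a *: x' + y'); rewrite !linearP /= -hx -hy.
Qed.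

HB.instance Definition _ :=
  GRing.isSubmodClosed.Build A cycles is_boundary is_boundary_closed.

Definition homology := modquot is_boundary.
HB.instance Definition _ := GRing.Lmodule.on homology.

Definition homology_class (z : cycles) : homology := modproj is_boundary z.

Definition homology_mod_torsion := modquot (torsion homology t).
HB.instance Definition _ := GRing.Lmodule.on homology_mod_torsion.

Definition hclass (z : cycles) : homology_mod_torsion :=
  modproj (torsion homology t) (homology_class z).

End Homology.

Section Induced.
Variables (A : comNzRingType) (M N : lmodType A).
Variables (d : {linear M -> M}) (e : {linear N -> N}) (s t : A).

(* The map [x] |-> [f x] from H_*(M/s)/t-torsion to H_*(N/s)/t-torsion exists
   and is an isomorphism. *)
Definition induces_iso (f : {linear M -> N}) : Prop :=
  exists phi : {linear homology_mod_torsion d s t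
                       -> homology_mod_torsion e s t},
    bijective phi /\
    forall (x : M) (z : cycles d s) (w : cycles e s),
      val z = projS s x -> val w = projS s (f x) ->
      phi (hclass t z) = hclass t w.

End Induced.

(** * Finitely generated free bigraded chain complexes over R *)

(* Elements of a free module of rank n are row vectors of coordinates; [gr i]
   is the bidegree (gr_U, gr_V) of the i-th basis element. *)
Definition grading (n : nat) := 'I_n -> int * int.

Definition homog n (gr : grading n) (p : int * int) (x : 'rV[R]_n) : Prop :=
  forall i, homogR (p - gr i) (x 0 i).

(* Matrices act on row vectors from the right, so that row i of a matrix is the
   image of the i-th basis element and the composite of f then g is f *m g. *)
Definition has_degree m n (gr : grading m) (gr' : grading n)
    (q : int * int) (f : 'M[R]_(m, n)) : Prop :=
  forall p x, homog gr p x -> homog gr' (p + q) (x *m f).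

Lemma has_degreeP m n (gr : grading m) (gr' : grading n) q (f : 'M[R]_(m, n)) :
  (forall i j, homogR (gr i + q - gr' j) (f i j)) -> has_degree gr gr' q f.
Proof.
move=> hf p x hx j; rewrite mxE.
apply: (big_ind (homogR (p + q - gr' j))); [exact: homogR0|exact: homogRD|].
move=> i _; have -> : p + q - gr' j = p - gr i + (gr i + q - gr' j).
  by rewrite -!addrA addKr.
exact: homogRM.
Qed.

Record complex := Complex {
  rk : nat;
  gr : grading rk;
  diff : 'M[R]_rk;
  diff_degree : has_degree gr gr (- 1, - 1) diff;
  diff_diff : diff *m diff = 0
}.

Definition bdry (C : complex) : {linear 'rV[R]_(rk C) -> 'rV[R]_(rk C)} :=
  mulmxr (diff C).

Definition chain_map (C D : complex) (f : 'M[R]_(rk C, rk D)) : Prop :=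
  diff C *m f = f *m diff D.

Definition homotopic (C D : complex) (f g : 'M[R]_(rk C, rk D)) : Prop :=
  exists2 h : 'M[R]_(rk C, rk D), has_degree (@gr C) (@gr D) (1, 1) h
    & f - g = diff C *m h + h *m diff D.

Definition homotopy_equivalent (C D : complex) : Prop :=
  exists (f : 'M[R]_(rk C, rk D)) (g : 'M[R]_(rk D, rk C)),
  [/\ chain_map f /\ has_degree (@gr C) (@gr D) 0 f,
      chain_map g /\ has_degree (@gr D) (@gr C) 0 g,
      @homotopic C C (f *m g) 1%:M
    & @homotopic D D (g *m f) 1%:M].

Section DirectSum.
Variables C D : complex.

Definition dsum_gr : grading (rk C + rk D) :=
  fun k => match split k with inl i => gr i | inr j => gr j end.

Definition dsum_diff : 'M[R]_(rk C + rk D) := block_mx (diff C) 0 0 (diff D).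

Lemma dsum_diff_degree : has_degree dsum_gr dsum_gr (- 1, - 1) dsum_diff.
Proof.
move=> p x hx; rewrite -[x]hsubmxK mul_row_block !mulmx0 addr0 add0r => k.
rewrite mxE /dsum_gr; case: (split k) => j.
  apply: diff_degree => i; have := hx (lshift _ i).
  by rewrite /dsum_gr (unsplitK (inl i)) mxE.
apply: diff_degree => i; have := hx (rshift _ i).
by rewrite /dsum_gr (unsplitK (inr i)) mxE.
Qed.

Lemma dsum_diff_diff : dsum_diff *m dsum_diff = 0.
Proof.
by rewrite mulmx_block !mulmx0 !mul0mx !diff_diff !addr0 block_mx0.
Qed.

Definition dsum : complex := Complex dsum_diff_degree dsum_diff_diff.

End DirectSum.

(** * Knot-like complexes and local equivalence *)

(* For (s, t) = (U, V) this says that H_*(C/U)/V-torsion is isomorphic to F[V]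
   as an F[V]-module, and symmetrically for (s, t) = (V, U). *)
Definition tower (C : complex) (s t : R) : Prop :=
  exists phi : {additive homology_mod_torsion (bdry C) s t -> {poly F}},
    bijective phi /\ forall h, phi (t *: h) = 'X * phi h.

(* Every homogeneous t-nontorsion class in H_*(C/s) has a bidegree in P. *)
Definition nontorsion_degrees (C : complex) (s t : R) (P : int * int -> Prop) :=
  forall p (x : 'rV[R]_(rk C)) (z : cycles (bdry C) s),
    homog (@gr C) p x -> val z = projS s x ->
    homology_class z \notin torsion (homology (bdry C) s) t -> P p.

Definition knot_like (C : complex) : Prop :=
  (tower C U V /\ nontorsion_degrees C U V (fun p => p.1 = 0)) /\
  (tower C V U /\ nontorsion_degrees C V U (fun p => p.2 = 0)).

Definition local_map (C D : complex) (f : 'M[R]_(rk C, rk D)) : Prop :=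
  [/\ chain_map f,
      exists c : int, has_degree (@gr C) (@gr D) (0, c) f
    & induces_iso (bdry C) (bdry D) U V (mulmxr f)].

Definition local_le (C D : complex) : Prop :=
  exists f : 'M[R]_(rk C, rk D), local_map f.

Definition locally_equivalent (C D : complex) : Prop :=
  local_le C D /\ local_le D C.

(** * Standard complexes *)

Section Standard.
(* The parameters b_1, ..., b_n are b`_0, ..., b`_(n-1), so that b`_k governs
   the arrow between x_k and x_{k+1}: a U-arrow when k is even and a V-arrow
   when k is odd. *)
Variable b : seq int.

Definition std_diff : 'M[R]_((size b).+1) :=
  \matrix_(i, j)
    if (j == i.+1 :> nat) && (b`_i < 0) then
      (if odd i then V else U) ^+ absz b`_i
    else if (i == j.+1 :> nat) && (0 < b`_j) then
      (if odd j then V else U) ^+ absz b`_j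
    else 0.

(* gr_U(x_{k+1}) - gr_U(x_k) and gr_V(x_{k+1}) - gr_V(x_k), as forced by the
   arrow between x_k and x_{k+1} having degree (-1, -1). *)
Definition std_stepU (k : nat) : int :=
  sgz b`_k - (if odd k then 0 else 2 * b`_k).
Definition std_stepV (k : nat) : int :=
  sgz b`_k - (if odd k then 2 * b`_k else 0).

Definition std_gr : grading (size b).+1 :=
  fun k => (\sum_(0 <= i < k) std_stepU i,
            - \sum_(k <= i < size b) std_stepV i).

Lemma homogRX (k m : nat) :
  homogR (if odd k then (0, - 2 *+ m) else (- 2 *+ m, 0))
         ((if odd k then V else U) ^+ m).
Proof.
right; case: (odd k); [exists 0%N, m|exists m, 0%N]; rewrite degUVE.
  by rewrite expr0 mul1r.
by rewrite expr0 mulr1.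
Qed.

Lemma std_gr_succ (i j : 'I_(size b).+1) : j = i.+1 :> nat ->
  std_gr j = std_gr i + (std_stepU i, std_stepV i).
Proof.
move=> ij; rewrite /std_gr ij; congr pair => /=.
  by rewrite big_nat_recr.
have lti : (i < size b)%N by rewrite -ltnS -ij.
by rewrite [in RHS]big_ltn //= opprD addrAC addNr add0r.
Qed.

Lemma mulrn_absz_neg (m : int) : m < 0 -> - 2 *+ absz m = - 1 - (- 1 - 2 * m).
Proof.
move=> m_lt0; have em : (absz m)%:Z = - m by lia.
by rewrite -(mulr_natr _ (absz m)) (natz (absz m)) em; ring.
Qed.

Lemma mulrn_absz_pos (m : int) : 0 < m -> - 2 *+ absz m = 1 - 2 * m - 1.
Proof.
move=> m_gt0; have em : (absz m)%:Z = m by lia.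
by rewrite -(mulr_natr _ (absz m)) (natz (absz m)) em; ring.
Qed.

Lemma addKAC (W : zmodType) (x y z : W) : x + y - (x + z) = y - z.
Proof. by rewrite opprD addrACA subrr add0r. Qed.

Lemma addKC (W : zmodType) (x y z : W) : x + y + z - x = y + z.
Proof. by rewrite -(addrA x) addrAC subrr add0r. Qed.

Lemma std_diff_degree : has_degree std_gr std_gr (- 1, - 1) std_diff.
Proof.
apply: has_degreeP => i j; rewrite mxE.
case: ifP => [/andP[/eqP ij bi]|_].
  have := homogRX i (absz b`_i); rewrite (std_gr_succ ij); congr homogR.
  rewrite addKAC /std_stepU /std_stepV (ltr0_sgz bi).
  by rewrite (mulrn_absz_neg bi); case: (odd i); apply: (f_equal2 pair); rewrite /= ?subr0 ?subrr.
case: ifP => [/andP[/eqP ij bj]|_]; last exact: homogR0.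
have := homogRX j (absz b`_j); rewrite (std_gr_succ ij); congr homogR.
rewrite addKC /std_stepU /std_stepV (gtr0_sgz bj).
by rewrite (mulrn_absz_pos bj); case: (odd j); apply: (f_equal2 pair); rewrite /= ?subr0 ?subrr.
Qed.

Lemma mulUV_exp k m n : (0 < m)%N -> (0 < n)%N ->
  (if odd k then V else U) ^+ m * (if odd k.+1 then V else U) ^+ n = 0.
Proof.
case: m n => // m [] // n _ _; rewrite /= !exprS mulrACA.
by case: (odd k); rewrite /= ?[V * U]mulrC mulUV mul0r.
Qed.

Lemma std_diff_diff : std_diff *m std_diff = 0.
Proof.
apply/matrixP => i k; rewrite !mxE big1 // => j _; rewrite !mxE.
case: andP => [[/eqP ij bi]|_].
  case: andP => [[_ bj]|_].
    by rewrite ij in bj *; rewrite mulUV_exp //; lia.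
  case: andP => [[/eqP jk bk]|_]; last by rewrite mulr0.
  have ik : i = k :> nat by lia.
  by move: bi bk; rewrite ik => h1 h2; lia.
case: andP => [[/eqP ij bj]|_]; last by rewrite mul0r.
case: andP => [[_ bj']|_]; first by lia.
case: andP => [[/eqP jk bk]|_]; last by rewrite mulr0.
by rewrite jk in bj *; rewrite mulrC mulUV_exp //; lia.
Qed.

Definition standard : complex := Complex std_diff_degree std_diff_diff.

End Standard.

(* Main.v *)
Require Import Defs.
From HB Require Import structures.
From mathcomp Require Import all_boot all_order all_algebra.
From mathcomp Require Import fingroup perm generic_quotient.
From mathcomp Require Import boolp.
From mathcomp Require Import zify.

(** Let [f : S -> C] and [g : C -> S] be local maps, [S] standard, and let [h]
be the self-map of [S] obtained from [f] followed by [g].  Modulo the maximal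
ideal [(U, V)], [h] fixes the coefficient of [x_0], because [h] induces an
isomorphism on the [V]-tower.  Comparing coefficients in [d h = h d] modulo [V]
and modulo [U] propagates this along the arrows to all diagonal coefficients,
and shows that [x_j] occurs in [h x_i] only if the sequence of arrows met when
walking from [x_i], starting with its [U]-arrow, is lexicographically at most
the one for [x_j].  As [n] is even these walks are pairwise distinct, so [h] is
triangular modulo [(U, V)]; its determinant is homogeneous of degree [0], hence
equal to [1], and the adjugate is a graded inverse of [h].  So [f] has the left
inverse [g' = h^-1 g], and [C] is homotopy equivalent to the sum of [S] and the
mapping cone of [f], which avoids choosing a basis of [ker g'].  The
[gr_V]-shift of [f] vanishes because [f x_n] generates a [U]-tower modulo
[V]. *)

Set Implicit Arguments.
Unset Strict Implicit.
Unset Printing Implicit Defensive.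

Import Order.TTheory GRing.Theory Num.Theory.
Local Open Scope ring_scope.
Local Open Scope quotient_scope.

Local Notation F := 'F_2.

(** * Reductions of [R] modulo [V] and modulo [U] *)

Definition rho_poly (k : bool) : {rmorphism polyUV -> {poly F}} :=
  if k then map_poly (horner_eval (0 : F)) : {rmorphism _ -> _}
  else horner_eval (0 : {poly F}) : {rmorphism _ -> _}.

Lemma rho_polyU k : rho_poly k polyU = if k then 0 else 'X.
Proof.
case: k => /=; rewrite /polyU; last by rewrite /horner_eval hornerC.
by rewrite map_polyC /= /horner_eval hornerX.
Qed.

Lemma rho_polyV k : rho_poly k polyV = if k then 'X else 0.
Proof.
case: k => /=; rewrite /polyV; last by rewrite /horner_eval hornerX.
by rewrite map_polyX.
Qed.

(* [k = false] kills [V] and [k = true] kills [U]; the surviving variable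
   becomes ['X]. *)
Definition rho (k : bool) (r : R) : {poly F} := rho_poly k (repr r).

(** Both colours kill [U V], so the choice of representative does not matter. *)
Lemma rhoE k (p : polyUV) : rho k (\pi_({ideal_quot idealUV}) p) = rho_poly k p.
Proof.
rewrite /rho; set q := repr _.
have : q == p %[mod {ideal_quot idealUV}] by rewrite reprK.
rewrite -Quotient.idealrBE => /asboolP[s e].
apply/eqP; rewrite -subr_eq0 -rmorphB e !rmorphM /= rho_polyU rho_polyV.
by case: k; rewrite ?mul0r ?mulr0.
Qed.

Lemma rho_is_zmod_morphism k : zmod_morphism (rho k).
Proof.
move=> x y; rewrite -[x]reprK -[y]reprK -(rmorphB (\pi_({ideal_quot idealUV}))).
by rewrite !rhoE rmorphB.
Qed.

Lemma rho_is_monoid_morphism k : monoid_morphism (rho k).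
Proof.
split; first by rewrite -(rmorph1 (\pi_({ideal_quot idealUV}))) rhoE rmorph1.
move=> x y; rewrite -[x]reprK -[y]reprK -(rmorphM (\pi_({ideal_quot idealUV}))).
by rewrite !rhoE rmorphM.
Qed.

HB.instance Definition _ k :=
  GRing.isZmodMorphism.Build R {poly F} (rho k) (rho_is_zmod_morphism k).
HB.instance Definition _ k :=
  GRing.isMonoidMorphism.Build R {poly F} (rho k) (rho_is_monoid_morphism k).

Lemma rhoU k : rho k U = if k then 0 else 'X.
Proof. by rewrite rhoE rho_polyU. Qed.

Lemma rhoV k : rho k V = if k then 'X else 0.
Proof. by rewrite rhoE rho_polyV. Qed.

(** Reduction modulo the maximal ideal [(U, V)]. *)
Definition aug (r : R) : F := (rho false r).[0].

Lemma augE k r : aug r = (rho k r).[0].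
Proof.
case: k => //; rewrite -[r]reprK /aug !rhoE /= /horner_eval.
by rewrite !horner_coef0 coef_map_id0 /= /horner_eval ?hornerC ?horner_coef0.
Qed.

HB.instance Definition _ := GRing.RMorphism.copy aug
  (horner_eval (0 : F) \o rho false).

Lemma homog_aug p r : homogR p r -> aug r != 0 -> p = 0 /\ r = 1.
Proof.
case=> [->|[i [j [-> ->]]]]; first by rewrite rmorph0 eqxx.
rewrite rmorphM !rmorphXn /= /aug rhoU rhoV hornerX hornerC.
case: i j => [|i] [|j].
- by move=> _; rewrite !expr0 mulr1 !mulr0n addr0.
- by rewrite [0 ^+ j.+1]expr0n mulr0 eqxx.
- by rewrite [0 ^+ i.+1]expr0n mul0r eqxx.
- by rewrite [0 ^+ i.+1]expr0n mul0r eqxx.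
Qed.

(** * Homogeneous matrices, determinants and adjugates *)

Lemma homog_delta n (gr : grading n) i : homog gr (gr i) (delta_mx 0 i).
Proof.
move=> l; rewrite mxE eqxx /=; case: eqP => [->|_]; last exact: homogR0.
by right; exists 0%N, 0%N; rewrite !mulr0n addr0 subrr mulr1.
Qed.

Lemma has_degree_entry m n (gr : grading m) (gr' : grading n) q
    (f : 'M[R]_(m, n)) i j :
  has_degree gr gr' q f -> homogR (gr i + q - gr' j) (f i j).
Proof.
by move=> /(_ _ _ (homog_delta gr i)); rewrite -rowE => /(_ j); rewrite mxE.
Qed.

Lemma homogR_prod (I : finType) (p : I -> int * int) (r : I -> R) :
  (forall i, homogR (p i) (r i)) -> homogR (\sum_i p i) (\prod_i r i).
Proof.
move=> hr; apply: (big_ind2 homogR) => //; last by move=> *; apply: homogRM.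
by right; exists 0%N, 0%N; rewrite !mulr0n addr0 mulr1.
Qed.

Lemma R_oppr (r : R) : - r = r.
Proof.
by apply/eqP; rewrite eq_sym -addr_eq0 -[r]mul1r -mulrDl R_char2 mul0r.
Qed.

Lemma homogR_signM (k : nat) p r : homogR p r -> homogR p ((-1) ^+ k * r).
Proof. by rewrite R_oppr expr1n mul1r. Qed.

(** A permutation only reorders the column degrees, so all terms of the Leibniz expansion have the
    same degree. *)
Lemma homogR_det m (g h : grading m) (A : 'M[R]_m) :
  (forall i j, homogR (g i - h j) (A i j)) ->
  homogR (\sum_i g i - \sum_j h j) (\det A).
Proof.
move=> hA; apply: (big_ind (homogR _)); [exact: homogR0|exact: homogRD|].
move=> s _; apply: homogR_signM.
rewrite [X in _ - X](reindex_inj (@perm_inj _ s)) /= -sumrB.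
exact: homogR_prod.
Qed.

(** The minor omits row [j] and column [i]; the remaining degrees telescope to [g i - g j]. *)
Lemma homogR_adjugate m (g : grading m) (A : 'M[R]_m) :
  (forall i j, homogR (g i - g j) (A i j)) ->
  forall i j, homogR (g i - g j) ((\adj A) i j).
Proof.
case: m g A => [|m] g A hA i j; first by case: i.
rewrite mxE /cofactor; apply: homogR_signM.
have -> : g i - g j = \sum_k g (lift j k) - \sum_l g (lift i l).
  have e k : \sum_l g l = g k + \sum_l g (lift k l) by rewrite (bigD1_ord k).
  rewrite -(addKr (g j) (\sum_k _)) -e (e i).
  by rewrite -addrA addrK addrC.
by apply: homogR_det => k l; rewrite !mxE.
Qed.

(** If the term of a permutation [s] is nonzero, then [r] weakly increases along each cycle of [s],
    hence is constant there, and injectivity gives [s = 1]. *)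
Lemma det_triangular_neq0 (K : fieldType) d (T : porderType d) m
    (r : 'I_m -> T) (A : 'M[K]_m) : injective r ->
  (forall i, A i i != 0) -> (forall i j, A i j != 0 -> (r i <= r j)%O) ->
  \det A != 0.
Proof.
move=> r_inj A_diag A_le.
rewrite /determinant (bigD1 1%g) //= [X in _ + X]big1 => [|s s1].
  rewrite addr0 odd_perm1 mul1r; apply/prodf_neq0 => i _.
  by rewrite perm1.
apply/eqP; rewrite mulf_eq0 signr_eq0 /=; apply: contraR s1 => /prodf_neq0 As.
have le_s i : (r i <= r (s i))%O by apply/A_le/As.
apply/eqP/permP => i; rewrite perm1; apply: r_inj; apply: le_anti.
rewrite le_s andbT -[leRHS](congr1 r (iter_order (@perm_inj _ s) i)).
rewrite -(prednK (fingraph.order_gt0 s i)) iterSr.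
by elim: _.-1 => //= k IH; apply: le_trans IH _.
Qed.

(** * Arrows of a standard complex and the walks along them *)

Section StandardArrows.
Variable b : seq int.
Local Notation n := (size b).
Local Notation idx := 'I_n.+1.

(* Colour [false] stands for [U] and [true] for [V].  [prt k i] is the other end
   of the arrow of colour [k] at [x_i]; [sym k i] is its label, read from [x_i]:
   negative if the arrow leaves [x_i], [0] if [x_i] has no arrow of colour [k]
   (in which case [prt k i] is meaningless). *)
Definition sym (k : bool) (i : nat) : int :=
  if odd i == k then b`_i else if i is i'.+1 then - b`_i' else 0.

Definition prt (k : bool) (i : nat) : nat := if odd i == k then i.+1 else i.-1.

Lemma prtK k i : sym k i != 0 -> prt k (prt k i) = i.
Proof.
rewrite /sym /prt; case: i => [|i] /=; first by case: k; rewrite ?eqxx.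
by case Ei: (odd i); case: k => //=; rewrite ?Ei.
Qed.

Lemma sym_prt k i : sym k i != 0 -> sym k (prt k i) = - sym k i.
Proof.
rewrite /sym /prt; case: i => [|i] /=; first by case: k; rewrite ?eqxx.
by case Ei: (odd i); case: k => //=; rewrite ?Ei ?opprK.
Qed.

(** This is the part of colour [k] of the differential: the arrows of the other colour reduce to
    0. *)
Definition std_mx (k : bool) : 'M[{poly F}]_n.+1 := map_mx (rho k) (std_diff b).

Lemma rho_arrow k (i m : nat) : (0 < m)%N ->
  rho k ((if odd i then V else U) ^+ m) = if odd i == k then 'X^m else 0.
Proof.
move=> m_gt0; rewrite rmorphXn /=; case: (odd i); rewrite ?rhoU ?rhoV;
by case: k; rewrite //= expr0n eqn0Ngt m_gt0.
Qed.

Lemma std_mxE k (i j : idx) :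
  std_mx k i j =
    if (sym k i < 0) && (j == prt k i :> nat) then 'X^(absz (sym k i)) else 0.
Proof.
rewrite !mxE; case: ifP => [/andP[/eqP ij bi]|nout].
  rewrite rho_arrow; last by lia.
  rewrite /sym /prt ij; case: ifP => oi; first by rewrite bi eqxx.
  by rewrite ifF //; apply/negP => /andP[_]; lia.
case: ifP => [/andP[/eqP ij bj]|nin].
  rewrite rho_arrow; last by lia.
  rewrite /sym /prt ij /=.
  have -> : (~~ odd j == k) = ~~ (odd j == k) by case: (odd j) k => [] [].
  case: ifP => oj /=; first by rewrite oppr_lt0 bj eqxx abszN.
  by rewrite ifF //; apply/negP => /andP[_]; lia.
rewrite rmorph0 ifF //; apply/negP => /andP[]; rewrite /sym /prt.
case: ifP => oi si ji; first by rewrite ji si in nout.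
case: (nat_of_ord i) si ji nin => //= i' si /eqP ->.
by rewrite eqxx -oppr_lt0 si.
Qed.

(** The same arrows seen from their targets, for computing products by columns. *)
Lemma std_mxE' k (i j : idx) :
  std_mx k i j =
    if (0 < sym k j) && (i == prt k j :> nat) then 'X^(absz (sym k j)) else 0.
Proof.
rewrite std_mxE; case: ifP => [/andP[si /eqP ji]|nout].
  have si0 : sym k i != 0 by rewrite lt_eqF.
  by rewrite ji prtK // eqxx sym_prt // oppr_gt0 si abszN.
rewrite ifF //; apply/negP => /andP[sj /eqP ij]; move: nout.
have sj0 : sym k j != 0 by rewrite gt_eqF.
by rewrite ij prtK // eqxx sym_prt // oppr_lt0 sj.
Qed.

Lemma std_mulE k m (h : 'M[{poly F}]_(n.+1, m)) (i i' : idx) j :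
  sym k i < 0 -> i' = prt k i :> nat ->
  (std_mx k *m h) i j = 'X^(absz (sym k i)) * h i' j.
Proof.
move=> si e; rewrite mxE (bigD1 i') //= big1 ?addr0.
  by rewrite std_mxE si e eqxx.
move=> l; rewrite -val_eqE /= e => /negPf nl.
by rewrite std_mxE nl andbF mul0r.
Qed.

Lemma std_mul0 k m (h : 'M[{poly F}]_(n.+1, m)) (i : idx) j :
  0 <= sym k i -> (std_mx k *m h) i j = 0.
Proof.
by move=> si; rewrite mxE big1 // => l _; rewrite std_mxE ltNge si mul0r.
Qed.

Lemma mul_stdE k m (h : 'M[{poly F}]_(m, n.+1)) i (j j' : idx) :
  0 < sym k j -> j' = prt k j :> nat ->
  (h *m std_mx k) i j = 'X^(absz (sym k j)) * h i j'.
Proof.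
move=> sj e; rewrite mxE (bigD1 j') //= big1 ?addr0.
  by rewrite std_mxE' sj e eqxx mulrC.
move=> l; rewrite -val_eqE /= e => /negPf nl.
by rewrite std_mxE' nl andbF mulr0.
Qed.

Lemma mul_std0 k m (h : 'M[{poly F}]_(m, n.+1)) i (j : idx) :
  sym k j <= 0 -> (h *m std_mx k) i j = 0.
Proof.
by move=> sj; rewrite mxE big1 // => l _; rewrite std_mxE' ltNge sj mulr0.
Qed.

Hypothesis b_neq0 : 0 \notin b.

(** The default value 0 of [nth] thus marks the right end of the complex. *)
Lemma nth_eq0 i : (b`_i == 0) = (n <= i)%N.
Proof.
case: leqP => h; first by rewrite nth_default ?eqxx.
by apply: contraNF b_neq0 => /eqP <-; apply: mem_nth.
Qed.

Lemma prt_ord k (i : idx) :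
  sym k i != 0 -> exists i' : idx, i' = prt k i :> nat.
Proof.
move=> si; suff h : (prt k i < n.+1)%N by exists (Ordinal h).
move: si; rewrite /sym /prt; case: ifP => _; last first.
  by move=> _; apply: leq_ltn_trans (leq_pred _) (ltn_ord i).
by rewrite nth_eq0 -ltnNge.
Qed.

(* The order -1 < -2 < ... < 0 < ... < 2 < 1 on arrow labels is the order of
   their inverses, with 0^-1 = 0. *)
Definition lab (k : bool) (i : nat) : rat := ((sym k i)%:~R)^-1.

Lemma invz_le (s t : int) :
  [\/ s <= 0 /\ 0 <= t, [/\ s < 0, t < 0 & (absz s <= absz t)%N]
    | [/\ 0 < s, 0 < t & (absz t <= absz s)%N]] ->
  (s%:~R)^-1 <= (t%:~R)^-1 :> rat.
Proof.
case=> [[s0 t0]|[s0 t0 st]|[s0 t0 st]].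
- by apply: (@le_trans _ _ 0); rewrite ?invr_le0 ?invr_ge0 ?lerz0 ?ler0z.
- by rewrite lef_nV2 ?negrE ?ltrz0 // ler_int; lia.
- by rewrite lef_pV2 ?posrE ?ltr0z // ler_int; lia.
Qed.

Lemma lab_inj k i j : lab k i = lab k j -> sym k i = sym k j.
Proof. by move=> /invr_inj /intr_inj. Qed.

(** The left side is divisible by ['X] exactly [a] times, as [p] has nonzero constant term. *)
Lemma mulX_coef0 (p q : {poly F}) (a c : nat) :
  'X^a * p = 'X^c * q -> p.[0] != 0 -> (c <= a)%N /\ (a = c -> p = q).
Proof.
move=> e p0; have Xn0 m : 'X^m != 0 :> {poly F} by rewrite monic_neq0 ?monicXn.
split=> [|ac]; last by move: e; rewrite ac => /(mulfI (Xn0 _)).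
rewrite leqNgt; apply: contra p0 => lt_ac.
move: e; rewrite -(subnKC lt_ac) addSnnS exprD -mulrA => /(mulfI (Xn0 _)) ->.
by rewrite exprS -mulrA hornerM hornerX mul0r.
Qed.

(** If arrows leave both [x_i] and [x_j], or enter both, one entry of the commutation relation
    equates power-of-['X] multiples of [h i j] and of the entry at the other ends, and [mulX_coef0]
    applies. In the mixed cases that would reverse the order of the labels, one side of such an
    entry is 0 and the other a nonzero multiple of [h i j]. *)
Lemma chain_compare k (h : 'M[{poly F}]_n.+1) (i j : idx) :
  std_mx k *m h = h *m std_mx k -> (h i j).[0] != 0 ->
  lab k i <= lab k j /\
  (sym k i = sym k j -> sym k i != 0 ->
   forall i' j' : idx, i' = prt k i :> nat -> j' = prt k j :> nat ->
   (h i' j').[0] != 0).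
Proof.
move=> /matrixP hd hij0.
have hij : h i j != 0 by apply: contraNneq hij0 => ->; rewrite horner0.
have Xh m : 'X^m * h i j != 0 by rewrite mulf_neq0 // monic_neq0 ?monicXn.
have ord_prt (l : idx) : sym k l != 0 ->
    exists2 l' : idx, l' = prt k l :> nat & l = prt k l' :> nat.
  by move=> sl; have [l' el] := prt_ord sl; exists l'; rewrite // el prtK.
have [si|si|si] := ltgtP (sym k i) 0; have [sj|sj|sj] := ltgtP (sym k j) 0.
- have [i' ei _] := ord_prt i (ltr0_neq0 si).
  have [j' ej ej'] := ord_prt j (ltr0_neq0 sj).
  have sj' : sym k j' = - sym k j by rewrite ej sym_prt // ltr0_neq0.
  have := hd i j'; rewrite (std_mulE _ _ si ei)
    (@mul_stdE _ _ _ _ _ j) //; last first.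
    by rewrite sj' oppr_gt0.
  rewrite sj' abszN => /esym/mulX_coef0 /(_ hij0) [le_ij eq_ij]; split.
    by apply: invz_le; apply: Or32.
  move=> eij _ i2 j2; rewrite -ei -ej => /val_inj -> /val_inj ->.
  by rewrite -eq_ij // eij.
- split=> [|eij]; last by move: si sj; rewrite eij; lia.
  by apply: invz_le; apply: Or31; lia.
- split=> [|eij]; last by move: si sj; rewrite eij; lia.
  by apply: invz_le; apply: Or31; lia.
- have [j' ej ej'] := ord_prt j (ltr0_neq0 sj).
  have sj' : sym k j' = - sym k j by rewrite ej sym_prt // ltr0_neq0.
  have := hd i j'; rewrite (std_mul0 _ _ (ltW si))
    (@mul_stdE _ _ _ _ _ j) //; last first.
    by rewrite sj' oppr_gt0.
  by move=> /esym/eqP; rewrite (negPf (Xh _)).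
- have [i' ei ei'] := ord_prt i (lt0r_neq0 si).
  have [j' ej _] := ord_prt j (lt0r_neq0 sj).
  have si' : sym k i' = - sym k i by rewrite ei sym_prt // lt0r_neq0.
  have := hd i' j; rewrite (mul_stdE _ _ sj ej)
    (@std_mulE _ _ _ _ i) //; last first.
    by rewrite si' oppr_lt0.
  rewrite si' abszN => /mulX_coef0 /(_ hij0) [le_ij eq_ij]; split.
    by apply: invz_le; apply: Or33.
  move=> eij _ i2 j2; rewrite -ei -ej => /val_inj -> /val_inj ->.
  by rewrite -eq_ij // eij.
- have [i' ei ei'] := ord_prt i (lt0r_neq0 si).
  have si' : sym k i' = - sym k i by rewrite ei sym_prt // lt0r_neq0.
  have := hd i' j; rewrite mul_std0 ?sj //
    (@std_mulE _ _ _ _ i) //; last first.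
    by rewrite si' oppr_lt0.
  by move=> /eqP; rewrite (negPf (Xh _)).
- have [j' ej ej'] := ord_prt j (ltr0_neq0 sj).
  have sj' : sym k j' = - sym k j by rewrite ej sym_prt // ltr0_neq0.
  have := hd i j'; rewrite std_mul0 ?si //
    (@mul_stdE _ _ _ _ _ j) //; last first.
    by rewrite sj' oppr_gt0.
  by move=> /esym/eqP; rewrite (negPf (Xh _)).
- split=> [|eij]; last by move: si sj; rewrite eij; lia.
  by apply: invz_le; apply: Or31; lia.
- by split=> //; rewrite /lab si sj.
Qed.

(* The labels met on the walk from [x_i] that starts with its arrow of colour
   [k]; [m] is the fuel, and the final [0] marks the end of the complex. *)
Fixpoint word (m : nat) (k : bool) (i : nat) : seqlexi rat :=
  if m is m'.+1 then
    lab k i :: (if sym k i == 0 then [::] else word m' (~~ k) (prt k i))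
  else [::].

(** Colours and parities alternate together, so a walk never turns back: it runs to the right end if
    its first arrow points to [x_(i+1)], else to the left end. The final 0 adds one letter. *)
Lemma size_word m k i : (i <= n)%N ->
  size (word m k i) = minn m (if odd i == k then (n - i).+1 else i.+1).
Proof.
elim: m k i => [|m IH] k i le_in; first by rewrite min0n.
rewrite /=; have [|si] := eqVneq (sym k i) 0.
  rewrite /= /sym; case: ifP => _.
    by move=> /eqP; rewrite nth_eq0; lia.
  case: i le_in => [|i] le_in; first by lia.
  by move=> /eqP; rewrite oppr_eq0 nth_eq0; lia.
have [i' /= ei] := @prt_ord k (Ordinal (le_in : (i < n.+1)%N)) si.
have le_i' : (prt k i <= n)%N by rewrite -ei -ltnS ltn_ord.
rewrite /= IH // {i' ei le_i'}; move: si; rewrite /sym /prt.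
case: ifP => oi.
  rewrite nth_eq0 -ltnNge => lt_in /=.
  rewrite [~~ odd i == ~~ k](_ : _ = true); first by lia.
  by case: (odd i) k oi => [] [].
case: i oi {le_in} => [//|i] /= oi.
rewrite (_ : (odd i == ~~ k) = false); first by lia.
by case: (odd i) k oi => [] [].
Qed.

(** The length determines [i]: it is [n - i + 1], which is odd, for even [i], and [i + 1], which is
    even, for odd [i]. *)
Lemma word_inj (i j : idx) : ~~ odd n ->
  word n.+1 false i = word n.+1 false j -> i = j.
Proof.
move=> even_n /(congr1 size); have := ltn_ord i; have := ltn_ord j.
rewrite !ltnS => lj li; rewrite !size_word // => e; apply: val_inj => /=.
by move: e; case: eqP => oi; case: eqP => oj; lia.
Qed.

(** * Chain self-maps of a standard complex modulo [(U, V)] *)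

Section Word.
Variable h : 'M[R]_n.+1.
Hypothesis hd : std_diff b *m h = h *m std_diff b.

Lemma chain_mx k :
  std_mx k *m map_mx (rho k) h = map_mx (rho k) h *m std_mx k.
Proof. by rewrite -!map_mxM hd. Qed.

(** When the first labels agree, the other ends of the two arrows again have a nonzero entry, and by
    [augE] the comparison continues in the other colour. *)
Lemma word_le m k (i j : idx) :
  aug (h i j) != 0 -> (word m k i <= word m k j)%O.
Proof.
elim: m k i j => //= m IH k i j; rewrite (augE k) => hij.
have [|le_ij eq_ij] := @chain_compare k (map_mx (rho k) h) i j (chain_mx k).
  by rewrite mxE.
rewrite lexi_cons le_ij /=; apply/implyP => ge_ij.
have sij : sym k i = sym k j by apply/(@lab_inj k)/le_anti; rewrite le_ij.
rewrite -sij; case: eqP => // /eqP si; have sj := si; rewrite sij in sj.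
have [i' ei] := prt_ord si; have [j' ej] := prt_ord sj.
rewrite -ei -ej; apply: IH; rewrite (augE k).
by have := eq_ij sij si i' j' ei ej; rewrite mxE.
Qed.

(** Comparing [x_m] with itself makes the labels equal, which carries nonvanishing along the arrow
    of colour [odd m] to [x_(m+1)]. *)
Lemma aug_diag : aug (h ord0 ord0) != 0 -> forall i, aug (h i i) != 0.
Proof.
move=> h0 i; rewrite -[i]inord_val; move: (ltn_ord i); move: (nat_of_ord i).
elim=> [|m IH] lt_m.
  by rewrite (_ : inord 0 = ord0) //; apply/val_inj; rewrite /= inordK.
have {IH} := IH (ltnW lt_m); set k := odd m; rewrite !(augE k) => hm.
have [|_] :=
  @chain_compare k (map_mx (rho k) h) (inord m) (inord m) (chain_mx k).
  by rewrite mxE.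
rewrite !inordK ?(ltnW lt_m) // /sym /prt eqxx nth_eq0 -ltnNge.
move=> /(_ erefl); rewrite ltnS in lt_m.
by move=> /(_ lt_m (inord m.+1) (inord m.+1)); rewrite mxE inordK //; apply.
Qed.

Lemma aug_det_neq0 : ~~ odd n -> aug (h ord0 ord0) != 0 -> aug (\det h) != 0.
Proof.
move=> even_n h0; rewrite -det_map_mx.
apply: (@det_triangular_neq0 _ _ _ _ (fun i : idx => word n.+1 false i)).
- by move=> i j; apply: word_inj.
- by move=> i; rewrite mxE aug_diag.
- by move=> i j; rewrite mxE; apply: word_le.
Qed.

End Word.

End StandardArrows.

(** * Cycles and classes in homology modulo torsion *)

Lemma hclass_surj (A : comNzRingType) (M : lmodType A) (d : {linear M -> M})
    (s t : A) (c : homology_mod_torsion d s t) : exists z, c = hclass t z.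
Proof.
exists (repr (repr c)); rewrite /hclass /homology_class.
by rewrite !modproj_repr.
Qed.

Lemma is_cycleP (A : comNzRingType) (M : lmodType A) (d : {linear M -> M})
    (s : A) (x : M) :
  (exists y, d x = s *: y) <-> exists z : cycles d s, val z = projS s x.
Proof.
split=> [[y dx]|[z zx]].
  suff zx : projS s x \in @is_cycle _ _ d s by exists (Cycle zx).
  apply/eqP; rewrite diffSE dx -(raddf0 (projS s)); apply/modproj_eq.
  by rewrite subr0; apply/asboolP; exists y.
have := valP z; rewrite unfold_in /is_cycle zx diffSE -(raddf0 (projS s)).
by move=> /eqP/modproj_eq; rewrite subr0 => /asboolP.
Qed.

(** Unwinds the three nested quotients into one equation in [M], to which [rho] can be applied. *)
Lemma hclass_eq (A : comNzRingType) (M : lmodType A) (d : {linear M -> M})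
    (s t : A) (x y : M) (z w : cycles d s) :
  val z = projS s x -> val w = projS s y -> hclass t z = hclass t w ->
  exists k u v, t ^+ k *: (x - y) = d u + s *: v.
Proof.
move=> zx wy /modproj_eq/asboolP[k].
rewrite /homology_class -linearB -linearZ -(raddf0 (modproj _)) => /modproj_eq.
rewrite subr0 => /asboolP[c hc]; exists k, (repr c).
have ce : projS s (repr c) = c by rewrite /projS modproj_repr.
move: hc; rewrite -{1}ce diffSE.
have -> : val (t ^+ k *: (z - w)) = projS s (t ^+ k *: (x - y)).
  by rewrite linearZ linearB /= zx wy -linearB -linearZ.
move=> /modproj_eq/asboolP[v hv]; exists v.
by rewrite -hv [RHS]addrC subrK.
Qed.

Lemma chain_map_cycle (C D : complex) (f : 'M[R]_(rk C, rk D)) s x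
    (z : cycles (bdry C) s) : chain_map f -> val z = projS s x ->
  exists w : cycles (bdry D) s, val w = projS s (x *m f).
Proof.
move=> fC zx; apply/is_cycleP.
have [|y /= dx] := (is_cycleP (bdry C) s x).2; first by exists z.
by exists (y *m f); rewrite /= -mulmxA -fC mulmxA dx scalemxAl.
Qed.

Lemma induces_iso_comp (C D E : complex) (f : 'M[R]_(rk C, rk D))
    (g : 'M[R]_(rk D, rk E)) (s t : R) : chain_map f ->
  induces_iso (bdry C) (bdry D) s t (mulmxr f) ->
  induces_iso (bdry D) (bdry E) s t (mulmxr g) ->
  induces_iso (bdry C) (bdry E) s t (mulmxr (f *m g)).
Proof.
move=> fC [phi [phi_bij phiE]] [psi [psi_bij psiE]].
exists (psi \o phi); split; first exact: bij_comp.
move=> x z w zx wx; have [y yx] := chain_map_cycle fC zx.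
rewrite /= (phiE _ _ _ zx yx); apply: (psiE _ _ _ yx).
by rewrite wx /= mulmxA.
Qed.

(** * The end generators [x_0] and [x_n] *)

Section StandardEnds.
Variable b : seq int.
Hypotheses (b_neq0 : 0 \notin b) (even_b : ~~ odd (size b)).
Local Notation S := (standard b).

Lemma scaled_vector m (s : R) (x : 'rV[R]_m) :
  (forall j, exists r, x 0 j = s * r) -> exists y, x = s *: y.
Proof.
move=> /choice[r xr]; exists (\row_j r j).
by apply/rowP => j; rewrite !mxE.
Qed.

(** Only a [U]-arrow can meet [x_0]. *)
Lemma bdry_first : exists y, bdry S (delta_mx 0 ord0) = U *: y.
Proof.
apply: scaled_vector => j; rewrite /= -rowE !mxE.
case: ifP => [/andP[_ b0]|_]; last by exists 0; rewrite mulr0.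
by exists (U ^+ (absz b`_0).-1); rewrite -exprS prednK ?absz_gt0 ?lt_eqF.
Qed.

(** As [n] is even, only a [V]-arrow can meet [x_n]. *)
Lemma bdry_last : exists y, bdry S (delta_mx 0 ord_max) = V *: y.
Proof.
apply: scaled_vector => j; rewrite /= -rowE !mxE /=.
case: ifP => [/andP[/eqP j_max _]|_].
  by move: (ltn_ord j); rewrite j_max /= ltnn.
case: ifP => [/andP[/eqP j_max bj]|_]; last by exists 0; rewrite mulr0.
exists (V ^+ (absz b`_j).-1); rewrite -exprS prednK ?absz_gt0 ?gt_eqF //.
by have := congr1 odd j_max; rewrite /= (negPf even_b) => /esym/negbFE ->.
Qed.

(** Surjectivity on the tower gives a cycle [x] modulo [U] whose image is homologous to [x_0] up to
    [V]-torsion. Modulo [U], the coefficient of [x_0] in that image is 1, and only the [x_0] term of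
    [x] contributes to it. *)
Lemma aug_first (h : 'M[R]_(rk S)) : @chain_map S S h ->
  induces_iso (bdry S) (bdry S) U V (mulmxr h) -> aug (h ord0 ord0) != 0.
Proof.
move=> hS [phi [[psi _ psiK] phiE]].
have [z0 z0E] := (is_cycleP (bdry S) U (delta_mx 0 ord0)).1 bdry_first.
have [z zE] := hclass_surj (psi (hclass V z0)).
set x := repr (val z).
have zx : val z = projS U x by rewrite /projS modproj_repr.
have [w wE] := chain_map_cycle hS zx.
have [k [u [v]]] : exists k u v,
    V ^+ k *: (x *m h - delta_mx 0 ord0) = bdry S u + U *: v.
  by apply: (hclass_eq wE z0E); rewrite -(phiE _ _ _ zx wE) -zE psiK.
have [|y dx] := (is_cycleP (bdry S) U x).2; first by exists z.
pose X := map_mx (rho true) x; pose H := map_mx (rho true) h.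
have XD : X *m std_mx b true = 0.
  rewrite -map_mxM; move: dx => /= ->.
  by rewrite map_mxZ /= rhoU scale0r.
have HD := chain_mx hS true.
move=> /(congr1 (map_mx (rho true))) /matrixP /(_ 0 ord0).
rewrite map_mxD !map_mxZ map_mxB !map_mxM rmorphXn /= rhoU rhoV scale0r addr0.
(* No [V]-arrow meets [x_0], so the boundary has no [x_0] coefficient. *)
rewrite mul_std0 // -/X -/H mxE [X in _ * X]mxE [X in _ + X]mxE.
rewrite map_delta_mx [X in - X]mxE !eqxx /=.
move=> /eqP; rewrite mulf_eq0 expf_eq0 polyX_eq0 andbF /= subr_eq0 => /eqP.
rewrite mxE (bigD1 ord0) //= big1 ?addr0 => [XH|j].
  apply/negP; rewrite (augE true) => /eqP h0.
  move/(congr1 (horner^~ 0))/eqP: XH.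
  by rewrite hornerM [H _ _]mxE h0 mulr0 hornerC eq_sym oner_eq0.
(* A [V]-arrow at [x_j] kills the coefficient of [x_j] in the cycle [x] if it
   leaves [x_j], and the coefficient of [x_0] in [h x_j] if it enters [x_j]. *)
rewrite -val_eqE /= -lt0n => j_gt0; have sj : sym b true j != 0.
  (* As [n] is even, every generator other than [x_0] meets a [V]-arrow. *)
  rewrite /sym; case: ifP => [/eqP oj|].
    rewrite nth_eq0 // -ltnNge.
    have := ltn_ord j; rewrite ltnS leq_eqVlt => /orP[/eqP ej|//].
    by have := congr1 odd ej; rewrite oj (negPf even_b).
  case: (nat_of_ord j) j_gt0 (ltn_ord j) => // i _ lt_i _.
  by rewrite oppr_eq0 nth_eq0 // -ltnNge.
have [i ei] := prt_ord b_neq0 sj.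
have ei' : j = prt true i :> nat by rewrite ei (prtK sj).
have si : sym b true i = - sym b true j by rewrite ei sym_prt.
have Xn0 m : 'X^m != 0 :> {poly F} by rewrite monic_neq0 ?monicXn.
have [sj_lt0|sj_gt0|sj_eq0] := ltgtP (sym b true j) 0.
- have := congr1 (fun A : 'rV_ _ => A 0 i) XD.
  rewrite (@mul_stdE b true _ _ _ i j) ?si ?oppr_gt0 // [RHS]mxE => /eqP.
  by rewrite mulf_eq0 (negPf (Xn0 _)) /= => /eqP ->; rewrite mul0r.
- have /matrixP/(_ i ord0) := HD.
  rewrite (@std_mulE b true _ _ i j) ?si ?oppr_lt0 // mul_std0 // => /eqP.
  by rewrite mulf_eq0 (negPf (Xn0 _)) /= => /eqP ->; rewrite mulr0.
- by rewrite sj_eq0 eqxx in sj.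
Qed.

End StandardEnds.

(** * Degrees of products, sums and block matrices *)

Lemma has_degreeM m n p (g1 : grading m) (g2 : grading n) (g3 : grading p)
    q r (A : 'M[R]_(m, n)) (B : 'M[R]_(n, p)) :
  has_degree g1 g2 q A -> has_degree g2 g3 r B ->
  has_degree g1 g3 (q + r) (A *m B).
Proof.
by move=> hA hB d x /hA /hB; rewrite mulmxA addrA.
Qed.

Lemma has_degree0 m n (g : grading m) (h : grading n) q : has_degree g h q 0.
Proof. by apply: has_degreeP => i j; rewrite mxE; left. Qed.

Lemma has_degree1 m (g h : grading m) q : (forall i, h i = g i + q) ->
  has_degree g h q 1%:M.
Proof.
move=> gh; apply: has_degreeP => i j; rewrite mxE.
case: eqP => [->|_]; last exact: homogR0.
by right; exists 0%N, 0%N; rewrite gh subrr !mulr0n addr0 mulr1.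
Qed.

Lemma has_degreeN m n (g : grading m) (h : grading n) q (A : 'M[R]_(m, n)) :
  has_degree g h q A -> has_degree g h q (- A).
Proof.
move=> hA; apply: has_degreeP => i j; rewrite mxE R_oppr.
exact: has_degree_entry.
Qed.

Lemma has_degreeD m n (g : grading m) (h : grading n) q (A B : 'M[R]_(m, n)) :
  has_degree g h q A -> has_degree g h q B -> has_degree g h q (A + B).
Proof.
move=> hA hB; apply: has_degreeP => i j; rewrite mxE.
by apply: homogRD; apply: has_degree_entry.
Qed.

Definition cat_gr m n (g : grading m) (h : grading n) : grading (m + n) :=
  fun k => match split k with inl i => g i | inr j => h j end.

Lemma has_degree_row m n p (g : grading m) (h1 : grading n) (h2 : grading p) q
    (A : 'M[R]_(m, n)) (B : 'M[R]_(m, p)) :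
  has_degree g h1 q A -> has_degree g h2 q B ->
  has_degree g (cat_gr h1 h2) q (row_mx A B).
Proof.
move=> hA hB; apply: has_degreeP => i j; rewrite mxE /cat_gr.
by case: (split j) => l; apply: has_degree_entry.
Qed.

Lemma has_degree_col m n p (g1 : grading m) (g2 : grading n) (h : grading p) q
    (A : 'M[R]_(m, p)) (B : 'M[R]_(n, p)) :
  has_degree g1 h q A -> has_degree g2 h q B ->
  has_degree (cat_gr g1 g2) h q (col_mx A B).
Proof.
move=> hA hB; apply: has_degreeP => i j; rewrite mxE /cat_gr.
by case: (split i) => l; apply: has_degree_entry.
Qed.

(** * Splitting by means of the mapping cone *)

Section Cone.
Variables (S C : complex) (f : 'M[R]_(rk S, rk C)).
Hypotheses (fS : chain_map f) (f_deg : has_degree (@gr S) (@gr C) 0 f).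

(* [(s, c) |-> (- d s, f s + d c)] on [S[1] + C]. *)
Definition cone_gr : grading (rk S + rk C) :=
  cat_gr (fun i => gr i + (1, 1)) (@gr C).

Definition cone_diff : 'M[R]_(rk S + rk C) := block_mx (- diff S) f 0 (diff C).

Lemma cone_diff_degree : has_degree cone_gr cone_gr (- 1, - 1) cone_diff.
Proof.
apply: has_degree_col; apply: has_degree_row.
- apply/has_degreeN/has_degreeP => i j.
  have := has_degree_entry i j (@diff_degree S).
  congr homogR; rewrite /= [gr i + _ + _ in RHS]addrAC.
  by rewrite [gr j + _]addrC addrKA.
- apply: has_degreeP => i j; have := has_degree_entry i j f_deg.
  congr homogR; rewrite addr0 -(addrA (gr i)).
  by rewrite (_ : (1, 1) + (-1, -1) = 0) ?addr0.
- exact: has_degree0.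
- exact: diff_degree.
Qed.

Lemma cone_diff_diff : cone_diff *m cone_diff = 0.
Proof.
rewrite mulmx_block !mulmx0 !mul0mx mulmxN !mulNmx !diff_diff fS addNr.
by rewrite !oppr0 !addr0 block_mx0.
Qed.

Definition cone : complex := Complex cone_diff_degree cone_diff_diff.

(** Here [e] projects onto the kernel of [g] along the image of [f]. The maps [c |-> (g c, (0, c))]
    and [(s, (s', c)) |-> f s + e c] compose on [C] exactly to the identity, so a homotopy is needed
    only on the sum. *)
Lemma split_cone (g : 'M[R]_(rk C, rk S)) :
  chain_map g -> has_degree (@gr C) (@gr S) 0 g -> f *m g = 1%:M ->
  homotopy_equivalent C (dsum S cone).
Proof.
move=> gC g_deg fg; pose e : 'M[R]_(rk C) := 1%:M - g *m f.
have deg1 m (gm : grading m) : has_degree gm gm 0 1%:M.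
  by apply: has_degree1 => i; rewrite addr0.
have fe : f *m e = 0 by rewrite mulmxBr mulmx1 mulmxA fg mul1mx subrr.
have eg : e *m g = 0 by rewrite mulmxBl mul1mx -mulmxA fg mulmx1 subrr.
have eC : diff C *m e = e *m diff C.
  by rewrite mulmxBr mulmxBl mulmx1 mul1mx mulmxA gC -!mulmxA fS.
exists (row_mx g (row_mx 0 1%:M)), (col_mx f (col_mx 0 e)); split.
- split.
    rewrite /chain_map /= /dsum_diff /cone_diff mul_mx_row mul_row_block.
    rewrite mul_mx_row mul_row_block !mulmx0 !mul0mx !mulmx1 !mul1mx gC.
    by rewrite !addr0 !add0r.
  apply: has_degree_row => //; apply: has_degree_row => //.
  exact: has_degree0.
- split.
    rewrite /chain_map /= /dsum_diff /cone_diff !mul_block_col.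
    rewrite !mul_col_mx !mulmx0 !mul0mx fe eC fS.
    by rewrite !addr0 !add0r.
  apply: has_degree_col => //; apply: has_degree_col.
    exact: has_degree0.
  apply: has_degreeD => //; apply: has_degreeN.
  by rewrite -[0]addr0; apply: has_degreeM g_deg f_deg.
- exists 0; first exact: has_degree0.
  rewrite mulmx0 mul0mx addr0 mul_row_col mul_row_col mul0mx add0r mul1mx.
  by rewrite /e [g *m f + _]addrC subrK subrr.
- (* (s, (s', c)) |-> (0, (s - g c, 0)) *)
  exists (block_mx 0 (row_mx 1%:M 0) 0 (block_mx 0 0 (- g) 0)).
    apply: has_degree_col; apply: has_degree_row;
      [exact: has_degree0| |exact: has_degree0|].
      by apply: has_degree_row; [apply: has_degree1|apply: has_degree0].
    apply: has_degree_col; apply: has_degree_row;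
      [exact: has_degree0|exact: has_degree0| |exact: has_degree0].
    apply/has_degreeN/has_degreeP => i j; have := has_degree_entry i j g_deg.
    by congr homogR; rewrite addr0 opprD addrACA subrr addr0.
  rewrite /= /dsum_diff /cone_diff !mulmx_block !mulmx0 !mul0mx !addr0 !add0r.
  have -> : 1%:M = block_mx 1%:M 0 0 (block_mx 1%:M 0 0 1%:M)
      :> 'M[R]_(rk S + (rk S + rk C)) by rewrite -!scalar_mx_block.
  rewrite mul_col_row fg mul_mx_row mulmx0 mulmx1 mul_col_mx mul0mx eg col_mx0.
  rewrite mul_col_row mul0mx !mulmx0 !mulmx1.
  rewrite !opp_block_mx !add_block_mx !mul_mx_row mul_row_block.
  rewrite !mulmx0 !mul1mx !mulmx1 !mul0mx.
  rewrite !addr0 !add0r !oppr0 !addr0 add_row_mx.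
  rewrite !subrr add0r !mulmxN !mulNmx opprK fg -gC addNr.
  by rewrite /e addrAC subrr sub0r.
Qed.

End Cone.

(** * Inverting the self-map and removing the grading shifts *)

Section StandardSelfMap.
Variable b : seq int.
Hypotheses (b_neq0 : 0 \notin b) (even_b : ~~ odd (size b)).
Local Notation S := (standard b).

Lemma adjugate_inverse q (h : 'M[R]_(rk S)) : @chain_map S S h ->
  has_degree (@gr S) (@gr S) q h -> aug (h ord0 ord0) != 0 ->
  [/\ q = 0, h *m \adj h = 1%:M, @chain_map S S (\adj h)
    & has_degree (@gr S) (@gr S) 0 (\adj h)].
Proof.
move=> hS h_deg h00.
have q0 : q = 0.
  (* A homogeneous entry that is nonzero modulo [(U, V)] has degree 0; on the diagonal this degree
     is [q]. *)
  have [] := homog_aug (has_degree_entry ord0 ord0 h_deg) h00.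
  by rewrite addrAC subrr add0r.
rewrite q0 in h_deg *.
have h_homog i j : homogR (gr (c := S) i - gr (c := S) j) (h i j).
  by have := has_degree_entry i j h_deg; rewrite addr0.
have det_h : \det h = 1.
  have [] // := homog_aug (homogR_det h_homog).
  exact: aug_det_neq0.
have hK : h *m \adj h = 1%:M by rewrite mul_mx_adj det_h.
have Kh : \adj h *m h = 1%:M by rewrite mul_adj_mx det_h.
split=> //.
  rewrite /chain_map -[LHS]mul1mx -Kh -!mulmxA; congr (_ *m _).
  by rewrite [LHS]mulmxA -hS -mulmxA hK mulmx1.
apply: has_degreeP => i j; rewrite addr0.
exact: homogR_adjugate.
Qed.

End StandardSelfMap.

(** If [f x_n] were [U]-torsion in homology modulo [V], then applying [g] would make a [U]-power
    multiple of [x_n] a boundary modulo [V], but no [U]-arrow meets [x_n]. *)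
Lemma split_shift_eq0 (b : seq int) (C : complex)
    (f : 'M[R]_(rk (standard b), rk C)) (g : 'M[R]_(rk C, rk (standard b)))
    (c : int) : ~~ odd (size b) ->
  nontorsion_degrees C V U (fun p => p.2 = 0) ->
  @chain_map (standard b) C f -> @chain_map C (standard b) g ->
  f *m g = 1%:M -> has_degree (@gr (standard b)) (@gr C) (0, c) f -> c = 0.
Proof.
move=> even_b degC fS gC fg f_deg; pose S := standard b.
pose e : 'rV[R]_(rk S) := delta_mx 0 ord_max.
have e_homog : homog (@gr S) (gr (c := S) ord_max) e by apply: homog_delta.
have [z0 z0E] := (is_cycleP (bdry S) V e).1 (bdry_last even_b).
have [z zE] := chain_map_cycle fS z0E.
have := degC _ _ z (f_deg _ _ e_homog) zE.
(* [x_n] has [gr_V] equal to 0, so [f x_n] has [gr_V] equal to [c]. *)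
rewrite /= /std_gr /= big_geq // oppr0 add0r; apply.
apply/negP => z_tors.
have [k [u [v]]] : exists k u v, U ^+ k *: (e *m f - 0) = bdry C u + V *: v.
  apply: (@hclass_eq _ _ (bdry C) V U _ _ z 0 zE); first by rewrite !raddf0.
  by apply/modproj_eq; rewrite -linearB subr0.
move=> /(congr1 (mulmxr g)) /=; rewrite subr0 mulmxDl -!scalemxAl.
rewrite -mulmxA fg mulmx1 -mulmxA gC mulmxA.
move=> /(congr1 (map_mx (rho false))) /matrixP /(_ 0 ord_max) /eqP.
rewrite map_mxD !map_mxZ !map_mxM rmorphXn /= rhoU rhoV scale0r addr0.
rewrite mul_std0; last by rewrite /sym /= (negPf even_b) nth_default.
rewrite map_delta_mx !mxE !eqxx mulr1.
by apply/negP; rewrite monic_neq0 ?monicXn.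
Qed.

Theorem corollary6p2 (C : complex) (n : nat) (a : n.-tuple int)
    (even_n : ~~ odd n) (a_neq0 : 0%R \notin a)
    (C_knot_like : knot_like C)
    (C_std : locally_equivalent C (standard a)) :
  exists A : complex, homotopy_equivalent C (dsum (standard a) A).
Proof.
have even_a : ~~ odd (size a) by rewrite size_tuple.
case: C_std => [[g [gC [c' g_deg] g_iso]] [f [fS [c f_deg] f_iso]]].
pose h := f *m g.
have hS : @chain_map (standard a) (standard a) h.
  by rewrite /chain_map mulmxA fS -mulmxA gC mulmxA.
have h00 := aug_first a_neq0 even_a hS (induces_iso_comp fS f_iso g_iso).
have [cc hK adjS adj_deg] :=
  adjugate_inverse a_neq0 even_a hS (has_degreeM f_deg g_deg) h00.
pose g' := g *m \adj h.
have g'C : @chain_map C (standard a) g'.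
  by rewrite /chain_map mulmxA gC -mulmxA adjS mulmxA.
have fg' : f *m g' = 1%:M by rewrite mulmxA.
have c0 := split_shift_eq0 even_a C_knot_like.2.2 fS g'C fg' f_deg.
(* By [cc] the shifts of [f] and [g] cancel. *)
have c'0 : c' = 0 by case: cc; rewrite c0 add0r.
rewrite c0 in f_deg; rewrite c'0 in g_deg.
exists (cone fS f_deg); apply: split_cone fg' => //.
by have := has_degreeM g_deg adj_deg; rewrite addr0.
Qed.
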